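(* Fix a positive integer $k$ and distinct $v_1,\dots, v_{2k-1}\in S^1$ with no two points antipodal. Let $u_1,\dots, u_{4k-2}$ denote the set of points $\{v_1, \dots, v_{2k-1}\}\cup \{v_1+\pi, \dots, v_{2k-1}+\pi\}$ labeled in counterclockwise order such that $u_1=v_1$. Then there exists a raked homogeneous trigonometric polynomial $f$ of degree $2k-1$ such that $f(u_i)=0$ for $1\leq i\leq 4k-2$. Further, for $1\le i\le 4k-2$, $\mathrm{sign}(f(t))=(-1)^i$ for all $t\in (u_i,u_{i+1})_{S^1}$, where we define $u_{4k-1}=u_1$.
   Context: $S^1=\mathbb{R}/2\pi\mathbb{Z}$. For $a\ne b$ in $S^1$, $(a,b)_{S^1}$ denotes the open arc traversed counterclockwise (in the direction of increasing $t$) from $a$ to $b$. A trigonometric polynomial is an expression $p(t)=c+\sum_{j=1}^n \bigl(a_j\cos(jt)+b_j\sin(jt)\bigr)$ with real coefficients, regarded as a function $S^1\to\mathbb{R}$. It is homogeneous if $c=0$. Its spectrum is the set of $j\in\{1,\dots,n\}$ with $a_j\ne 0$ or $b_j\neq 0$, and its degree is the largest element of its spectrum. It is raked if its spectrum consists only of odd integers. *)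

(* Defs.v *)
From HB Require Import structures.
From mathcomp Require Import all_boot all_order all_algebra.
From mathcomp Require Import generic_quotient ring_quotient.
From mathcomp Require Import all_classical all_reals all_analysis.

Set Implicit Arguments.
Unset Strict Implicit.
Unset Printing Implicit Defensive.

Import Order.TTheory GRing.Theory Num.Theory.

Local Open Scope ring_scope.
Local Open Scope classical_set_scope.

Definition two_pi_int (R : realType) : {pred R} :=
  fun x : R => x / (pi *+ 2) \is a Num.int.
Arguments two_pi_int : clear implicits.

Lemma two_pi_int_zmod_closed (R : realType) : zmod_closed (two_pi_int R).
Proof.
split; first by rewrite unfold_in mul0r rpred0.
by move=> x y; rewrite unfold_in => xZ yZ; rewrite unfold_in mulrBl; exact: rpredB.
Qed.

HB.instance Definition _ (R : realType) :=
  GRing.isZmodClosed.Build R (two_pi_int R) (@two_pi_int_zmod_closed R).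

(* S^1 = R / 2 pi Z, as a quotient of additive groups. *)
Definition circle (R : realType) : zmodType := Quotient.quot (two_pi_int R).
Arguments circle : clear implicits.

Definition to_circle (R : realType) (x : R) : circle R :=
  (\pi_(Quotient.quot (two_pi_int R)) x)%qT.

Definition of_circle (R : realType) (t : circle R) : R :=
  repr (t : Quotient.quot (two_pi_int R)).

Lemma of_circleK (R : realType) : cancel (@of_circle R) (@to_circle R).
Proof. exact: reprK. Qed.

Lemma to_circleD (R : realType) : {morph @to_circle R : x y / x + y}.
Proof. by move=> x y; rewrite /to_circle raddfD. Qed.

Lemma to_circle_eqP (R : realType) (x y : R) :
  to_circle x = to_circle y <-> exists m : int, x = y + m%:~R * (pi *+ 2).
Proof.
have pi2_neq0 : (pi *+ 2 : R) != 0 by rewrite mulrn_eq0 /= gt_eqF ?pi_gt0.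
have -> : to_circle x = to_circle y <-> x - y \in two_pi_int R.
  by rewrite Quotient.idealrBE; split=> [/eqP|/eqP].
rewrite unfold_in; split=> [/intrP[m xyE]|[m ->]].
  by exists m; rewrite -xyE mulfVK// addrC subrK.
by rewrite addrC addKr mulfK// intr_int.
Qed.

Definition antipodal (R : realType) (a b : circle R) : Prop :=
  b = a + to_circle pi.

(* The counterclockwise open arc (a, b), for a != b: lift a to any x and b to
   the unique y in ]x, x + 2 pi[. *)
Definition open_arc (R : realType) (a b : circle R) : set (circle R) :=
  [set t | exists x s y : R,
     [/\ to_circle x = a, to_circle s = t, to_circle y = b &
         [/\ x < s, s < y & y < x + pi *+ 2]]].

(* The points u 1, ..., u N are listed in counterclockwise order, going at most
   once around the circle. In particular they are pairwise distinct. *)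
Definition counterclockwise (R : realType) (N : nat) (u : nat -> circle R)
    : Prop :=
  exists x : nat -> R,
    [/\ forall i, (1 <= i <= N)%N -> to_circle (x i) = u i,
        forall i j, (1 <= i)%N -> (i < j)%N -> (j <= N)%N -> x i < x j &
        x N < x 1%N + pi *+ 2].

(* c + \sum_(1 <= j <= n) (a j * cos (j t) + b j * sin (j t)); the values of
   a and b outside 1, ..., n are irrelevant. *)
Record trig_poly (R : realType) := TrigPoly {
  tp_size : nat;
  tp_const : R;
  tp_cos : nat -> R;
  tp_sin : nat -> R }.

Definition tp_eval (R : realType) (p : trig_poly R) (x : R) : R :=
  tp_const p + \sum_(1 <= j < (tp_size p).+1)
    (tp_cos p j * cos (j%:R * x) + tp_sin p j * sin (j%:R * x)).

Definition tp_fun (R : realType) (p : trig_poly R) (t : circle R) : R :=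
  tp_eval p (of_circle t).

Definition spectrum (R : realType) (p : trig_poly R) : seq nat :=
  [seq j <- iota 1 (tp_size p) | (tp_cos p j != 0) || (tp_sin p j != 0)].

Definition degree (R : realType) (p : trig_poly R) : nat :=
  (\max_(j <- spectrum p) j)%N.

Definition homogeneous (R : realType) (p : trig_poly R) : Prop :=
  tp_const p = 0.

Definition raked (R : realType) (p : trig_poly R) : Prop :=
  forall j, j \in spectrum p -> odd j.

Lemma periodicz (R : realType) (f : R -> R) (T : R) :
  periodic f T -> forall (m : int) x, f (x + m%:~R * T) = f x.
Proof.
move=> fT [n|n] x; first by rewrite -pmulrn mulr_natl periodicn.
by rewrite NegzE mulrNz mulNr -pmulrn mulr_natl -(periodicn fT n.+1) subrK.
Qed.

Lemma tp_funE (R : realType) (p : trig_poly R) (x : R) :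
  tp_fun p (to_circle x) = tp_eval p x.
Proof.
have /to_circle_eqP[m xE] := of_circleK (to_circle x).
rewrite /tp_fun /tp_eval xE; congr (_ + _); apply: eq_bigr => j _.
have -> : j%:R * (x + m%:~R * (pi *+ 2)) =
          j%:R * x + ((j%:Z * m)%:~R * (pi *+ 2)) :> R.
  by rewrite mulrDr intrM mulrA -pmulrn.
by rewrite (periodicz (@cosD2pi R)) (periodicz (@sinD2pi R)).
Qed.

(* Main.v *)
Require Import Defs.
From mathcomp Require Import all_boot all_order all_algebra.
From mathcomp Require Import all_classical all_reals all_analysis.
From mathcomp Require Import zify ring lra.

Import Order.TTheory GRing.Theory Num.Theory.
Local Open Scope ring_scope.
Local Open Scope classical_set_scope.

(* Lift the u_i to reals x_1 < ... < x_N < x_1 + 2 pi, with N = 4 k - 2, and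
   take f(t) = \prod_i sin ((t - x_i) / 2). On each arc every factor has a
   constant sign, and N - i of them are negative on the i-th one. On the other
   hand the u_i come in antipodal pairs, and
   sin ((t - a) / 2) sin ((t - a - pi) / 2) = - sin (t - a) / 2, so f is a
   nonzero multiple of \prod_j sin (t - v_j), a product of 2 k - 1 sines, which
   is raked of degree exactly 2 k - 1 by the product-to-sum formulas. *)

(** * Trigonometric sums with frequencies of one parity *)

Definition harmonic (R : realType) (al be : R) (j : nat) (t : R) : R :=
  al * cos (j%:R * t) + be * sin (j%:R * t).

(* Index 0 is allowed here: products of an even number of sines have a
   constant term. *)
Definition lower_harmonics (R : realType) (n : nat) (g : R -> R) : Prop :=
  exists c s : nat -> R,
    (forall j, odd j != odd n -> c j = 0 /\ s j = 0) /\
    forall t, g t = \sum_(j < n) harmonic R (c j) (s j) j t.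

(** The parity condition in [lower_harmonics] makes this record rakedness as well as degree when [n]
    is odd. The top coefficients enter through their squared amplitude because multiplying by a sine
    merely rescales it. *)
Definition exact_degree (R : realType) (n : nat) (f : R -> R) : Prop :=
  exists al be g, [/\ al ^+ 2 + be ^+ 2 != 0, lower_harmonics R n g &
    forall t, f t = harmonic R al be n t + g t].

Section TrigSums.
Variable R : realType.
Implicit Types (f g h : R -> R) (n j : nat) (al be a t : R).

Lemma eq_lower_harmonics n g h :
  g =1 h -> lower_harmonics R n g -> lower_harmonics R n h.
Proof. by move=> /funext ->. Qed.

Lemma eq_exact_degree n f g :
  f =1 g -> exact_degree R n f -> exact_degree R n g.
Proof. by move=> /funext ->. Qed.

Lemma lower_harmonicsD n g h :
  lower_harmonics R n g -> lower_harmonics R n h ->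
  lower_harmonics R n (fun t => g t + h t).
Proof.
move=> [c [s [cs gE]]] [c' [s' [cs' hE]]].
exists (fun j => c j + c' j), (fun j => s j + s' j); split=> [j jn|t].
  by have [-> ->] := cs _ jn; have [-> ->] := cs' _ jn; rewrite addr0.
rewrite gE hE -big_split; apply: eq_bigr => j _ /=; rewrite /harmonic; ring.
Qed.

Lemma lower_harmonics0 n : lower_harmonics R n (fun=> 0).
Proof.
exists (fun=> 0), (fun=> 0); split=> // t.
by rewrite big1// => j _; rewrite /harmonic !mul0r addr0.
Qed.

Lemma lower_harmonics_sum n m (F : nat -> R -> R) :
  (forall j, (j < m)%N -> lower_harmonics R n (F j)) ->
  lower_harmonics R n (fun t => \sum_(j < m) F j t).
Proof.
elim: m => [|m IHm] Fn.
  by apply: eq_lower_harmonics (lower_harmonics0 n) => t; rewrite big_ord0.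
apply: (eq_lower_harmonics _ (fun t => \sum_(j < m) F j t + F m t)).
  by move=> t; rewrite big_ord_recr.
by apply: lower_harmonicsD; [apply: IHm => j jm; exact/Fn/ltnW | exact: Fn].
Qed.

Lemma lower_harmonics_harmonic n j al be :
  (j < n)%N -> odd j = odd n -> lower_harmonics R n (harmonic R al be j).
Proof.
move=> jn jodd.
exists (fun i => if i == j then al else 0), (fun i => if i == j then be else 0).
split=> [i|t]; first by case: (i =P j) => [->|_]; rewrite ?jodd ?eqxx.
rewrite (bigD1 (Ordinal jn)) //= eqxx big1 ?addr0// => i.
by rewrite -val_eqE /= => /negPf ->; rewrite /harmonic !mul0r addr0.
Qed.

(** Product-to-sum formulas. Starting from frequency [j.+1] keeps the lowered frequency [j] a
    natural number. *)
Lemma harmonic_mul_sin al be j a t :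
  harmonic R al be j.+1 t * sin (t - a) =
    harmonic R (- (al * sin a + be * cos a) / 2)
               ((al * cos a - be * sin a) / 2) j.+2 t +
    harmonic R ((be * cos a - al * sin a) / 2)
               (- (al * cos a + be * sin a) / 2) j t.
Proof.
rewrite /harmonic.
have -> : j.+2%:R * t = j.+1%:R * t + t by rewrite -[j.+2]addn1 natrD; ring.
have -> : j%:R * t = j.+1%:R * t - t by rewrite -[j.+1]addn1 natrD; ring.
by rewrite !(sinB, cosB, cosD, sinD); field.
Qed.

(** Each frequency moves up or down by one, so the parity flips together with that of the bound. *)
Lemma lower_harmonics_mul_sin n g a :
  lower_harmonics R n g -> lower_harmonics R n.+1 (fun t => g t * sin (t - a)).
Proof.
move=> [c [s [cs gE]]].
apply: (eq_lower_harmonics _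
  (fun t => \sum_(j < n) harmonic R (c j) (s j) j t * sin (t - a))).
  by move=> t; rewrite gE mulr_suml.
apply: (lower_harmonics_sum _ _
  (fun j t => harmonic R (c j) (s j) j t * sin (t - a))) => j jn.
have [jodd|/cs[-> ->]] := eqVneq (odd j) (odd n); last first.
  apply: eq_lower_harmonics (lower_harmonics0 _) => t.
  by rewrite /harmonic !mul0r addr0 mul0r.
(* Frequency 0 cannot be lowered: a constant times [sin (t - a)] is already a single harmonic of
   frequency 1. *)
case: j jn jodd => [|j] jn jodd.
  apply: (eq_lower_harmonics _
    (harmonic R (- c 0%N * sin a) (c 0%N * cos a) 1)).
    by move=> t; rewrite /harmonic !(mul0r, mul1r) sin0 cos0 sinB; ring.
  by apply: lower_harmonics_harmonic => //=; rewrite -jodd.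
apply: eq_lower_harmonics.
  by move=> t; rewrite harmonic_mul_sin.
by apply: lower_harmonicsD; apply: lower_harmonics_harmonic;
  rewrite /= -?jodd ?negbK// ltnW// ltnW.
Qed.

(** The top harmonic splits into frequencies [n.+2] and [n]. The squared amplitude of the former is
    a quarter of the old one, hence nonzero; the latter joins the lower terms. *)
Lemma exact_degree_mul_sin n f a :
  exact_degree R n.+1 f -> exact_degree R n.+2 (fun t => f t * sin (t - a)).
Proof.
move=> [al [be [g [nz gn fE]]]].
exists (- (al * sin a + be * cos a) / 2), ((al * cos a - be * sin a) / 2).
exists (fun t => harmonic R ((be * cos a - al * sin a) / 2)
  (- (al * cos a + be * sin a) / 2) n t + g t * sin (t - a)); split.
- have -> : (- (al * sin a + be * cos a) / 2) ^+ 2 +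
      ((al * cos a - be * sin a) / 2) ^+ 2 =
      (al ^+ 2 + be ^+ 2) * (cos a ^+ 2 + sin a ^+ 2) / 4 by field.
  by rewrite cos2Dsin2 mulr1 mulf_neq0// invr_eq0 pnatr_eq0.
- apply: lower_harmonicsD; last exact: lower_harmonics_mul_sin.
  by apply: lower_harmonics_harmonic; [exact: ltnW | rewrite /= negbK].
- by move=> t; rewrite fE mulrDl harmonic_mul_sin -addrA.
Qed.

(** The list is nonempty so that the induction starts from [e * sin (t - a)], of exact degree 1,
    where [exact_degree_mul_sin] applies. *)
Lemma exact_degree_prod_sin (e : R) a (l : seq R) : e != 0 ->
  exact_degree R (size l).+1
    (fun t => e * \prod_(b <- a :: l) sin (t - b)).
Proof.
move=> e0.
(* The remaining sines are absorbed into [f] one at a time, hence the generalization over [m] and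
   [f]. *)
have H m f : exact_degree R m.+1 f -> exact_degree R (m + size l).+1
    (fun t => f t * \prod_(b <- l) sin (t - b)).
  elim: l m f => [|b l IHl] m f fm.
    rewrite addn0; apply: eq_exact_degree fm => t.
    by rewrite big_nil mulr1.
  rewrite /= addnS; apply: eq_exact_degree (IHl _ _ (exact_degree_mul_sin _ _ b fm)).
  by move=> t; rewrite big_cons mulrA.
apply: (eq_exact_degree _
  (fun t => e * sin (t - a) * \prod_(b <- l) sin (t - b))).
  by move=> t; rewrite big_cons mulrA.
apply: (H 0%N (fun t => e * sin (t - a))).
exists (- e * sin a), (e * cos a), (fun=> 0); split.
- have -> : (- e * sin a) ^+ 2 + (e * cos a) ^+ 2 =
    e ^+ 2 * (cos a ^+ 2 + sin a ^+ 2) by ring.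
  by rewrite cos2Dsin2 mulr1 expf_neq0.
- exact: lower_harmonics0.
- by move=> t; rewrite /harmonic !mul1r sinB; ring.
Qed.

(** For odd [n], index 0 has the wrong parity, so the sum has no constant term and the polynomial
    can be given constant 0. *)
Lemma exact_degree_trig_poly n f : odd n -> exact_degree R n f ->
  exists p : trig_poly R, [/\ raked p, homogeneous p, degree p = n &
    forall t, tp_eval p t = f t].
Proof.
move=> nodd [al [be [g [nz [c [s [cs gE]]] fE]]]].
have n0 : (0 < n)%N by case: n nodd {cs gE fE}.
pose p := TrigPoly n 0 (fun j => if j == n then al else c j)
  (fun j => if j == n then be else s j).
have nspec : n \in spectrum p.
  rewrite mem_filter mem_iota /= eqxx n0 add1n ltnSn andbT.
  apply: contraNT nz; rewrite andbT negb_or !negbK => /andP[/eqP -> /eqP ->].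
  by rewrite expr0n addr0.
exists p; split=> //.
- move=> j; rewrite mem_filter /=; case: (j =P n) => [-> _|_] //.
  move=> /andP[jnz _]; apply: contraTT jnz => jeven.
  have [|-> ->] := cs j; first by rewrite nodd (negPf jeven).
  by rewrite eqxx.
- apply/eqP; rewrite eqn_leq; apply/andP; split.
    apply/bigmax_leqP_seq => j; rewrite mem_filter mem_iota => /andP[_].
    by rewrite /= => jn _; lia.
  exact: (@leq_bigmax_seq _ _ xpredT id).
- move=> t; rewrite fE gE /tp_eval add0r /= big_nat_recr//= eqxx addrC.
  congr (_ + _).
  rewrite -(big_mkord xpredT (fun j => harmonic R (c j) (s j) j t)).
  rewrite [RHS]big_ltn//.
  have [|-> ->] := cs 0%N; first by rewrite nodd.
  rewrite [X in X + _]/harmonic !mul0r !add0r; apply: eq_big_nat => j /andP[_ jn].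
  by rewrite ltn_eqF.
Qed.

End TrigSums.

(** * Half-angle sines: change of lift, antipodal pairs, signs *)

Section HalfSines.
Variable R : realType.
Implicit Types (x y a b s t : R).

Lemma sin_intr_pi (m : int) : sin (m%:~R * pi : R) = 0.
Proof.
have H n : sin (n%:R * pi : R) = 0.
  elim: n => [|n IHn]; first by rewrite mul0r sin0.
  by rewrite -[n.+1]addn1 natrD mulrDl mul1r sinDpi IHn oppr0.
by case: m => n; rewrite ?NegzE ?mulrNz ?mulNr ?sinN -pmulrn H ?oppr0.
Qed.

(** The half-angle sine is not a function on the circle, since a shift by [2 pi] changes its sign.
    Replacing a lift by another one, [m] turns away, multiplies it by [cos (m pi)], which is nonzero
    because [sin (m pi) = 0]. *)
Lemma half_sin_lift x y : to_circle x = to_circle y ->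
  exists2 e : R, e != 0 & forall t, sin ((t - x) / 2) = e * sin ((t - y) / 2).
Proof.
move=> /to_circle_eqP[m ->]; exists (cos (m%:~R * pi)).
  apply/eqP => c0; have := cos2Dsin2 (m%:~R * pi : R).
  by rewrite sin_intr_pi c0 expr0n addr0 => /eqP; rewrite eq_sym oner_eq0.
move=> t; have -> : (t - (y + m%:~R * (pi *+ 2))) / 2 =
  (t - y) / 2 - m%:~R * pi by rewrite -mulr_natr; field.
by rewrite sinB sin_intr_pi mulr0 subr0 mulrC.
Qed.

Lemma prod_proportional (I : eqType) (r : seq I) (F G : I -> R -> R) :
  (forall i, i \in r ->
    exists2 e : R, e != 0 & forall t, F i t = e * G i t) ->
  exists2 e : R, e != 0 &
    forall t, \prod_(i <- r) F i t = e * \prod_(i <- r) G i t.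
Proof.
elim: r => [|i r IHr] FG.
  by exists 1 => [|t]; rewrite ?oner_eq0// !big_nil mulr1.
have [e1 e1_neq0 E1] := FG i (mem_head _ _).
have [|e2 e2_neq0 E2] := IHr.
  by move=> j jr; apply: FG; rewrite inE jr orbT.
exists (e1 * e2) => [|t]; first exact: mulf_neq0.
by rewrite !big_cons E1 E2 mulrACA.
Qed.

Lemma prod_half_sin_antipodal (r : seq (circle R)) :
  exists2 e : R, e != 0 & forall t,
    \prod_(p <- r ++ [seq p + to_circle pi | p <- r])
      sin ((t - of_circle p) / 2) =
    e * \prod_(p <- r) sin (t - of_circle p).
Proof.
have [p _|e e0 E] := prod_proportional _ r
  (fun p t => sin ((t - of_circle p) / 2) *
              sin ((t - of_circle (p + to_circle pi)) / 2))
  (fun p t => sin (t - of_circle p)); last first.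
  by exists e => // t; rewrite -E big_cat big_map big_split.
have [|e e0 E] := half_sin_lift (of_circle (p + to_circle pi))
  (of_circle p + pi).
  by rewrite to_circleD !of_circleK.
(* With [h = (t - of_circle p) / 2], one has [sin h * sin (h - pi / 2) = - sin h * cos h = - sin (2
   h) / 2]; the factor [e] accounts for the chosen representative of the antipode. *)
exists (- e / 2) => [|t]; first by rewrite mulf_neq0 ?oppr_eq0 ?invr_eq0.
have -> : (t - of_circle p) = ((t - of_circle p) / 2) *+ 2.
  by rewrite -mulr_natr divfK.
rewrite sin_mulr2n E.
have -> : (t - (of_circle p + pi)) / 2 = (t - of_circle p) / 2 - pi / 2 by field.
by rewrite -(mulr_natr _ 2) mulfK// sinBpihalf -mulr_natr; field.
Qed.

Lemma to_circle_inj_near x y :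
  to_circle x = to_circle y -> `|x - y| < pi *+ 2 -> x = y.
Proof.
have pi2_gt0 : (0 : R) < pi *+ 2 by rewrite mulrn_wgt0 ?pi_gt0.
move=> /to_circle_eqP[m ->]; rewrite addrC addKr normrM (gtr0_norm pi2_gt0).
rewrite gtr_pMl// -intr_norm ltrz1 => m1.
have -> : m = 0 by lia.
by rewrite mul0r addr0.
Qed.

Lemma open_arc_lift a b (t : circle R) : a < b -> b < a + pi *+ 2 ->
  open_arc (to_circle a) (to_circle b) t ->
  exists s, [/\ to_circle s = t, a < s & s < b].
Proof.
move=> ab ba [x [s [y [/to_circle_eqP[m xE] <- yb [xs sy yx]]]]].
have shift z : to_circle (z - m%:~R * (pi *+ 2)) = to_circle z :> circle R.
  by apply/to_circle_eqP; exists (- m); rewrite mulrNz mulNr.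
(* Both sides lift the same point and lie strictly between [a] and [a + 2 pi], so they coincide. *)
have <- : y - m%:~R * (pi *+ 2) = b.
  by apply: to_circle_inj_near; [rewrite shift | rewrite ltr_norml; lra].
exists (s - m%:~R * (pi *+ 2)); split; [exact: shift | lra | lra].
Qed.

(** Halving puts the differences in []0, pi[] for [j <= i] and in []- pi, 0[] for [j > i], where the
    sign of the sine is known. *)
Lemma sgr_prod_half_sin (N i : nat) (x : nat -> R) s :
  (i <= N)%N ->
  (forall j, (1 <= j <= i)%N -> 0 < s - x j < pi *+ 2) ->
  (forall j, (i < j <= N)%N -> - (pi *+ 2) < s - x j < 0) ->
  Num.sg (\prod_(1 <= j < N.+1) sin ((s - x j) / 2)) = (-1) ^+ (N - i).
Proof.
move=> iN pos neg; rewrite (big_morph _ (@sgrM R) (@sgr1 R)).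
rewrite (big_cat_nat (n := i.+1))//= big_nat_cond big1 ?mul1r.
  rewrite (eq_big_nat _ _ (F2 := fun=> -1)) ?prodr_const_nat ?subSS// => j.
  rewrite ltnS => ij; have /andP[lo hi] := neg j ij.
  apply/ltr0_sg; rewrite -oppr_gt0 -sinN; apply: sin_gt0_pi.
  by rewrite -mulr_natr in lo; apply/andP; split; lra.
move=> j; rewrite ltnS andbT => ji; have /andP[lo hi] := pos j ji.
apply/gtr0_sg/sin_gt0_pi; rewrite -mulr_natr in hi.
by apply/andP; split; lra.
Qed.

End HalfSines.

(** * The product over the lifted points and its signs on the arcs *)

Theorem theorem26 (R : realType) (k : nat) (v u : nat -> circle R)
  (k_gt0 : (0 < k)%N)
  (v_distinct : forall i j, (1 <= i <= 2 * k - 1)%N ->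
     (1 <= j <= 2 * k - 1)%N -> v i = v j -> i = j)
  (v_not_antipodal : forall i j, (1 <= i <= 2 * k - 1)%N ->
     (1 <= j <= 2 * k - 1)%N -> ~ antipodal (v i) (v j))
  (u_points : [set u i | i in [set i | (1 <= i <= 4 * k - 2)%N]] =
     [set v i | i in [set i | (1 <= i <= 2 * k - 1)%N]] `|`
     [set v i + to_circle pi | i in [set i | (1 <= i <= 2 * k - 1)%N]])
  (u_ccw : counterclockwise (4 * k - 2) u)
  (u_first : u 1%N = v 1%N)
  (u_cyclic : u (4 * k - 1)%N = u 1%N) :
  exists f : trig_poly R,
    [/\ raked f, homogeneous f, degree f = (2 * k - 1)%N,
        forall i, (1 <= i <= 4 * k - 2)%N -> tp_fun f (u i) = 0 &
        forall i, (1 <= i <= 4 * k - 2)%N ->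
          forall t, t \in open_arc (u i) (u i.+1) ->
            Num.sg (tp_fun f t) = (-1) ^+ i].
Proof.
have pi2_gt0 : (0 : R) < pi *+ 2 by rewrite mulrn_wgt0 ?pi_gt0.
case: u_ccw => x [xu x_incr x_wrap].
set n := (2 * k - 1)%N in v_distinct v_not_antipodal u_points *.
set N := (4 * k - 2)%N in u_points u_cyclic xu x_incr x_wrap *.
have n_odd : odd n by rewrite /n; lia.
have N_even : odd N = false by rewrite /N; lia.
have N_ge2 : (2 <= N)%N by rewrite /N; lia.
have SN : (4 * k - 1)%N = N.+1 by rewrite /N; lia.
rewrite SN in u_cyclic.
have x_le i j : (1 <= i)%N -> (i <= j)%N -> (j <= N)%N -> x i <= x j.
  move=> i1; rewrite leq_eqVlt => /predU1P[-> //|ij jN].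
  by apply/ltW/x_incr.
have x_near i j : (1 <= i <= N)%N -> (1 <= j <= N)%N -> x i - x j < pi *+ 2.
  move=> /andP[i1 iN] /andP[j1 jN].
  have := x_le i N i1 iN (leqnn _); have := x_le 1%N j isT j1 jN; lra.
have u_inj : {in iota 1 N &, injective u}.
  have lt_neq i j : (1 <= i)%N -> (i < j)%N -> (j <= N)%N -> u i <> u j.
    move=> i1 ij jN uij; have xij := x_incr i j i1 ij jN.
    have iN : (1 <= i <= N)%N by rewrite i1 (leq_trans (ltnW ij)).
    have jN' : (1 <= j <= N)%N by rewrite jN (leq_trans i1 (ltnW ij)).
    suff : x i = x j by lra.
    apply: to_circle_inj_near; first by rewrite !xu.
    by have := x_near j i jN' iN; rewrite ltr_norml; lra.
  move=> i j; rewrite !mem_iota => iN jN uij.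
  have [ij|ij|//] := ltngtP i j; first by case: (lt_neq i j) => //; lia.
  by case: (lt_neq j i) => //; lia.
(* [u_points] only equates sets. Rewriting products needs a permutation, so both lists must be
   duplicate-free: on the right this is distinctness of the [v i] together with the absence of
   antipodal pairs. *)
have perm_u : perm_eq [seq u i | i <- iota 1 N]
    ([seq v i | i <- iota 1 n] ++
     [seq p + to_circle pi | p <- [seq v i | i <- iota 1 n]]).
  apply: uniq_perm.
  - by rewrite map_inj_in_uniq ?iota_uniq.
  - have uniq_v : uniq [seq v i | i <- iota 1 n].
      rewrite map_inj_in_uniq ?iota_uniq// => i j.
      by rewrite !mem_iota => iN jN; apply: v_distinct; lia.
    rewrite cat_uniq uniq_v (map_inj_uniq (addIr _)) uniq_v andbT /=.
    apply/hasPn => _ /mapP[_ /mapP[i iN ->] ->]; apply/mapP => -[j jN].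
    rewrite !mem_iota in iN jN.
    by move=> /esym; apply: v_not_antipodal; lia.
  - have iotaE m i : (i \in iota 1 m) = (1 <= i <= m)%N by rewrite mem_iota; lia.
    move=> p; rewrite mem_cat -map_comp.
    have mapE (w : nat -> circle R) m : p \in [seq w i | i <- iota 1 m] <->
        [set w i | i in [set i | (1 <= i <= m)%N]] p.
      split=> [/mapP[i]|[i /= iN <-]]; last by apply: map_f; rewrite iotaE.
      by rewrite iotaE => iN ->; exists i.
    apply/idP/orP => [/mapE|pv].
      by rewrite u_points => -[] /mapE; [left|right].
    by apply/mapE; rewrite u_points; case: pv => /mapE; [left|right].
(* The increasing lifts [x i] are used so that signs can be counted. The constant [e] below has
   unspecified sign, so the polynomial is made equal to [g] itself rather than to the product of
   full-angle sines. *)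
pose g t := \prod_(1 <= i < N.+1) sin ((t - x i) / 2).
have [e e_neq0 gE] : exists2 e : R, e != 0 & forall t,
    g t = e * \prod_(b <- [seq of_circle (v i) | i <- iota 1 n]) sin (t - b).
  have [i iN|e1 e1_neq0 E1] := prod_proportional _ _ (iota 1 N)
    (fun i t => sin ((t - x i) / 2))
    (fun i t => sin ((t - of_circle (u i)) / 2)).
    by apply: half_sin_lift; rewrite of_circleK xu//; rewrite mem_iota in iN; lia.
  have [e2 e2_neq0 E2] := prod_half_sin_antipodal _ [seq v i | i <- iota 1 n].
  exists (e1 * e2) => [|t]; first exact: mulf_neq0.
  rewrite /g /index_iota subn1 E1.
  rewrite -(big_map u xpredT (fun p => sin ((t - of_circle p) / 2))).
  by rewrite (perm_big _ perm_u) E2 mulrA !big_map.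
have [f [f_raked f_hom f_deg fE]] : exists p : trig_poly R,
    [/\ raked p, homogeneous p, degree p = n & forall t, tp_eval p t = g t].
  apply: exact_degree_trig_poly => //.
  have := exact_degree_prod_sin R e (of_circle (v 1%N))
    [seq of_circle (v i) | i <- iota 2 n.-1] e_neq0.
  rewrite size_map size_iota.
  have -> : n.-1.+1 = n by rewrite prednK// odd_gt0.
  apply: eq_exact_degree => t; rewrite gE.
  by have -> : n = n.-1.+1 by rewrite prednK// odd_gt0.
exists f; split=> //.
- move=> i iN; rewrite -xu// tp_funE fE /g.
  rewrite (bigD1_seq i) ?iota_uniq ?mem_index_iota//=.
  by rewrite subrr mul0r sin0 mul0r.
move=> i iN t; rewrite in_setE.
(* The lift of the end of the arc is [x i.+1], except for [i = N], where it is [x 1 + 2 pi]. The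
   last two bounds place any [s] in []x i, y[] relative to all the [x j], as the sign count
   requires. *)
have [y [yu /andP[xy y_lt] y_wrap y_le]] : exists y,
    [/\ to_circle y = u i.+1, x i < y < x i + pi *+ 2, y <= x 1%N + pi *+ 2 &
        forall j, (i < j <= N)%N -> y <= x j].
  have /andP[i1] := iN; rewrite leq_eqVlt => /predU1P[->|iltN].
    exists (x 1%N + pi *+ 2); split=> //; last by move=> j; lia.
      rewrite u_cyclic -xu; last by lia.
      by apply/to_circle_eqP; exists 1; rewrite mul1r.
    by rewrite x_wrap ltrD2r x_incr.
  have iSN : (1 <= i.+1 <= N)%N by [].
  exists (x i.+1); split.
  - by rewrite xu.
  - by rewrite x_incr//=; have := x_near i.+1 i iSN iN; lra.
  - by have := x_near i.+1 1%N iSN (ltnW N_ge2); lra.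
  - by move=> j ij; apply: x_le; lia.
rewrite -xu// -yu => /open_arc_lift[] //.
move=> s [<- xs sy]; rewrite tp_funE fE (sgr_prod_half_sin _ _ i); last first.
- move=> j jN; have jN' : (1 <= j <= N)%N by lia.
  by have := y_le j jN; have := x_near j i jN' iN; lra.
- move=> j /andP[j1 ji]; have /andP[_ i_le] := iN.
  have := x_le j i j1 ji i_le.
  by have := x_le 1%N j isT j1 (leq_trans ji i_le); lra.
- by lia.
(* Since [N] is even, [N - i] and [i] have the same parity. *)
by rewrite -signr_odd oddB ?N_even ?signr_odd//; lia.
Qed.
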